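(* Let $p$ be a prime. If $R$ is a non-commutative ring with unity and $|R|=p^4$, then $\Gamma_R$ is MSN-integral but not MSN-hyperenergetic.
   Context: For a ring $R$, $Z(R)$ is its center. For a finite non-commutative ring $R$, the commuting graph $\Gamma_R$ is the simple graph with vertex set $R\setminus Z(R)$ in which two distinct vertices are adjacent if they commute. Let $\Gamma$ be a finite simple graph with vertices $v_1,\dots,v_n$. Let $N(v_i)$ be the set of vertices adjacent to $v_i$, let $N^2(v_i)=\big(\bigcup_{u\in N(v_i)}N(u)\big)\setminus\{v_i\}$, and let $\delta_2(v_i)=\sum_{x\in N^2(v_i)}\deg x$. The minimum second neighborhood degree matrix $\mathrm{snm}(\Gamma)$ is the $n\times n$ matrix whose $(i,j)$ entry is $\min\{\delta_2(v_i),\delta_2(v_j)\}$ if $i\neq j$ and $v_i,v_j$ are adjacent, and $0$ otherwise. The MSN-energy $E_{\mathrm{sn}}(\Gamma)$ is the sum of the absolute values of the eigenvalues of $\mathrm{snm}(\Gamma)$, counted with multiplicity. $\Gamma$ is MSN-integral if all eigenvalues of $\mathrm{snm}(\Gamma)$ are integers, and MSN-hyperenergetic if $E_{\mathrm{sn}}(\Gamma)>E_{\mathrm{sn}}(K_n)$, where $K_n$ is the complete graph on $n=|V(\Gamma)|$ vertices. *)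

(* Defs.v *)
From HB Require Import structures.
From mathcomp Require Import all_boot all_order all_algebra all_field.

Set Implicit Arguments.
Unset Strict Implicit.
Unset Printing Implicit Defensive.

Import Order.TTheory GRing.Theory Num.Theory.

Local Open Scope ring_scope.

Record simple_graph := SimpleGraph {
  vertex :> finType;
  adj : rel vertex;
  adj_sym : symmetric adj;
  adj_irrefl : irreflexive adj }.

Definition neighbors (G : simple_graph) (v : G) : {set G} :=
  [set u | adj v u].

Definition degree (G : simple_graph) (v : G) : nat := #|neighbors v|.

Definition second_neighbors (G : simple_graph) (v : G) : {set G} :=
  (\bigcup_(u in neighbors v) neighbors u) :\ v.

Definition delta2 (G : simple_graph) (v : G) : nat :=
  (\sum_(x in second_neighbors v) degree x)%N.

(* The entries are natural numbers, so all complex eigenvalues of this matrix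
   are algebraic: they all lie in algC. *)
Definition snm (G : simple_graph) : 'M[algC]_#|G| :=
  \matrix_(i, j)
    let u : G := enum_val i in let v : G := enum_val j in
    if (i != j) && adj u v then (minn (delta2 u) (delta2 v))%:R else 0.

(* The roots of the characteristic polynomial, each repeated according to its
   multiplicity. *)
Definition eigenvalues n (A : 'M[algC]_n) : seq algC :=
  sval (closed_field_poly_normal (char_poly A)).

Lemma char_poly_eigenvalues n (A : 'M[algC]_n) :
  char_poly A = \prod_(z <- eigenvalues A) ('X - z%:P).
Proof.
rewrite /eigenvalues; case: closed_field_poly_normal => s /= {1}->.
by rewrite (monicP (char_poly_monic A)) scale1r.
Qed.

Lemma mem_eigenvalues n (A : 'M[algC]_n) (a : algC) :
  (a \in eigenvalues A) = eigenvalue A a.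
Proof.
by rewrite eigenvalue_root_char char_poly_eigenvalues root_prod_XsubC.
Qed.

Definition msn_energy (G : simple_graph) : algC :=
  \sum_(z <- eigenvalues (snm G)) `|z|.

Definition msn_integral (G : simple_graph) : Prop :=
  forall a : algC, eigenvalue (snm G) a -> a \is a Num.int.

Definition complete_adj (n : nat) : rel 'I_n := fun i j => i != j.

Lemma complete_adj_sym n : symmetric (@complete_adj n).
Proof. by move=> i j; rewrite /complete_adj eq_sym. Qed.

Lemma complete_adj_irrefl n : irreflexive (@complete_adj n).
Proof. by move=> i; rewrite /complete_adj eqxx. Qed.

Definition complete_graph (n : nat) : simple_graph :=
  SimpleGraph (@complete_adj_sym n) (@complete_adj_irrefl n).

(* The order on algC is partial, but both energies are sums of norms, hence
   real, so they are always comparable. *)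
Definition msn_hyperenergetic (G : simple_graph) : Prop :=
  msn_energy (complete_graph #|G|) < msn_energy G.

Definition ring_center (R : finNzRingType) : {set R} :=
  [set x | [forall y, x * y == y * x]].

Definition commuting_adj (R : finNzRingType) :
    rel {x : R | x \notin ring_center R} :=
  fun x y => (x != y) && (val x * val y == val y * val x).

Lemma commuting_adj_sym R : symmetric (@commuting_adj R).
Proof. by move=> x y; rewrite /commuting_adj eq_sym [_ * _ == _]eq_sym. Qed.

Lemma commuting_adj_irrefl R : irreflexive (@commuting_adj R).
Proof. by move=> x; rewrite /commuting_adj eqxx. Qed.

Definition commuting_graph (R : finNzRingType) : simple_graph :=
  SimpleGraph (@commuting_adj_sym R) (@commuting_adj_irrefl R).

(* Main.v *)
(* Centralizers of noncentral elements are commutative: a noncommutative one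
   would produce a chain of additive subgroups of length 5 in a group of order
   p^4. Hence the commuting graph is a disjoint union of cliques. On such a
   graph [snm] is block diagonal with blocks d (J - I), where J is the all-ones
   matrix, so its eigenvalues are integers. Since [snm + D] and [D] are positive
   semidefinite, D being the diagonal matrix of the d's, the energy is at most
   2 tr D. No vertex commutes with all n - 1 others, so each d is at most
   (n - 2)^2, and 2 tr D <= 2 n (n - 2)^2 <= 2 (n - 1)^3, which is a lower bound
   for the energy of the complete graph: there (n - 1)^3 is an eigenvalue and
   the trace vanishes. *)

Require Import Defs.
From HB Require Import structures.
From mathcomp Require Import all_boot all_order all_algebra all_field.
From mathcomp Require Import fingroup pgroup zify.

Set Implicit Arguments.
Unset Strict Implicit.
Unset Printing Implicit Defensive.

Import Order.TTheory GRing.Theory Num.Theory.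

Local Open Scope ring_scope.
Local Open Scope sesquilinear_scope.

(** * Eigenvalue lists, traces and bounds on sums of norms *)

(** Both sides are minus the coefficient of degree n - 1 of the characteristic polynomial; n = 0 has
    no such coefficient and is treated apart. *)
Lemma sum_eigenvalues n (A : 'M[algC]_n) : \sum_(z <- eigenvalues A) z = \tr A.
Proof.
have sz : size (eigenvalues A) = n.
  by have := size_char_poly A; rewrite char_poly_eigenvalues size_prod_XsubC => -[].
case: (posnP n) => [n0|n_gt0].
  move: sz; rewrite {2}n0 => /size0nil ->; rewrite big_nil /mxtrace big1 // => i.
  by exfalso; case: i => k; rewrite {1}n0.
apply: oppr_inj; rewrite -char_poly_trace // char_poly_eigenvalues.
have := @coefPn_prod_XsubC _ (eigenvalues A).
by rewrite sz -lt0n => ->.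
Qed.

(** Similar matrices have the same characteristic polynomial, and a product of monic linear factors
    determines its roots up to order. *)
Lemma eigenvalues_diagonalized n (A P : 'M[algC]_n) (d : 'rV[algC]_n) :
  P \in unitmx -> A = invmx P *m diag_mx d *m P ->
  perm_eq (eigenvalues A) [seq d 0 i | i : 'I_n].
Proof.
move=> Pu defA; apply: prod_XsubC_eq; rewrite -char_poly_eigenvalues big_map big_enum /=.
transitivity (char_poly (diag_mx d)); last first.
  rewrite char_poly_trig ?diag_mx_is_trig //.
  by apply: eq_bigr => i _; rewrite mxE eqxx.
rewrite /char_poly /char_poly_mx defA !map_mxM /=.
set Q := map_mx _ (invmx P); set P' := map_mx _ P.
have QP : Q *m P' = 1%:M by rewrite -map_mxM mulVmx // map_mx1.
set D := map_mx _ (diag_mx d).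
have -> : 'X%:M - Q *m D *m P' = Q *m ('X%:M - D) *m P'.
  by rewrite mulmxBr mulmxBl scalar_mxC -(mulmxA 'X%:M) QP mulmx1.
by rewrite !det_mulmx mulrAC -det_mulmx QP det1 mul1r.
Qed.

Lemma diag_gram_ge0 m n (B : 'M[algC]_(m, n)) i : 0 <= (B *m B^t*) i i.
Proof.
by rewrite mxE sumr_ge0 // => k _; rewrite !mxE -normCK exprn_ge0.
Qed.

(* In an orthonormal eigenbasis each eigenvalue is the difference of the
   corresponding diagonal entries, both nonnegative, of the two Gram matrices. *)
Lemma sum_norm_eigenvalues_subgram n m k
    (B : 'M[algC]_(n, m)) (C : 'M[algC]_(n, k)) :
  \sum_(z <- eigenvalues (B *m B^t* - C *m C^t*)) `|z|
    <= \tr (B *m B^t*) + \tr (C *m C^t*).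
Proof.
set A := _ - _.
have trgram q (X : 'M[algC]_(n, q)) : (X *m X^t*)^t* = X *m X^t*.
  by rewrite trmx_mul map_mxM trmxCK.
have hermA : A^t* = A by rewrite /A raddfB /= map_mxB !trgram.
have normA : A \is normalmx by apply/normalmxP; rewrite hermA.
have [P [d [Pu defA]]] : exists P d, P \is unitarymx /\
    A = invmx P *m diag_mx d *m P.
  exists (spectralmx A), (spectral_diag A).
  by split; [exact: spectral_unitarymx | exact/orthomx_spectralP].
have Pi := invmx_unitary Pu; have PU := unitarymx_unit Pu.
rewrite (perm_big _ (eigenvalues_diagonalized PU defA)) big_map big_enum /=.
have gram_conj q (X : 'M[algC]_(n, q)) :
    (P *m X) *m (P *m X)^t* = P *m (X *m X^t*) *m P^t*.
  by rewrite trmx_mul map_mxM !mulmxA.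
have tr_conj q (X : 'M[algC]_(n, q)) :
    \tr (X *m X^t*) = \tr ((P *m X) *m (P *m X)^t*).
  by rewrite gram_conj [RHS]mxtrace_mulC mulmxA -Pi mulVmx // mul1mx.
rewrite (tr_conj _ B) (tr_conj _ C) -big_split /=; apply: ler_sum => i _.
have -> : d 0 i = ((P *m B) *m (P *m B)^t*) i i - ((P *m C) *m (P *m C)^t*) i i.
  transitivity ((P *m A *m P^t*) i i).
    by rewrite defA -Pi -!mulmxA mulmxV // mulmx1 mulmxA mulmxV // mul1mx mxE eqxx.
  by rewrite !gram_conj /A mulmxBr mulmxBl mxE [X in _ + X]mxE.
rewrite (le_trans (ler_normB _ _)) //.
by rewrite !ger0_norm ?diag_gram_ge0.
Qed.

(** * Matrices with blocks w (J - I) *)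

(** The label [f i] names the block of the index [i], so no reordering of the indices is needed to
    speak of blocks. *)
Definition cluster_mx n (T : finType) (f : 'I_n -> T) (w : T -> nat) : 'M[algC]_n :=
  \matrix_(i, j) if (i != j) && (f i == f j) then (w (f i))%:R else 0.

Section ClusterMatrix.

Variables (n : nat) (T : finType) (f : 'I_n -> T) (w : T -> nat).
Let M := cluster_mx f w.

Lemma mulmx_cluster_mx (x : 'rV[algC]_n) j :
  (x *m M) 0 j = (w (f j))%:R * (\sum_(i | f i == f j) x 0 i - x 0 j).
Proof.
rewrite mxE [in RHS](bigD1 j) //= [X in _ = _ * X]addrC addKr mulr_sumr [RHS]big_mkcond /=.
apply: eq_bigr => i _; rewrite mxE andbC; case: ifP => [/andP[/eqP -> _]|_].
  by rewrite mulrC.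
by rewrite mulr0.
Qed.

Lemma eigenvalue_cluster_mx_int a : eigenvalue M a -> a \is a Num.int.
Proof.
case/eigenvalueP => x xM x0.
have xE j : a * x 0 j = (w (f j))%:R * (\sum_(i | f i == f j) x 0 i - x 0 j).
  by rewrite -mulmx_cluster_mx xM mxE.
have /rV0Pn[j xj0] := x0.
(* If the block sum [c] of the eigenvector is zero, then a = -w; otherwise summing the eigenvector
   equation over the block, of size m, gives a = w (m - 1). *)
pose c := \sum_(i | f i == f j) x 0 i; have [c0|c0] := eqVneq c 0.
  have := xE j; rewrite -/c c0 sub0r mulrN -mulNr => /(mulIf xj0) ->.
  by rewrite rpredN rpred_nat.
have : a * c = ((w (f j))%:R * (#|[pred i | f i == f j]|%:R - 1)) * c.
  transitivity (\sum_(k | f k == f j) (w (f j))%:R * (c - x 0 k)).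
    by rewrite /c mulr_sumr; apply: eq_bigr => k /eqP fk; rewrite xE fk.
  by rewrite -mulr_sumr sumrB sumr_const -mulrA mulrBl mul1r (mulr_natl c).
by move/(mulIf c0) ->; rewrite rpredM ?rpredB ?rpred_nat ?rpred1.
Qed.

Lemma mxtrace_cluster_mx : \tr M = 0.
Proof. by rewrite /mxtrace big1 // => i _; rewrite mxE eqxx. Qed.

(* [M + diag w] is the block matrix whose diagonal blocks are multiples of the
   all-ones matrix, hence a Gram matrix; so is the diagonal matrix [diag w]. *)
Lemma sum_norm_eigenvalues_cluster_mx :
  \sum_(z <- eigenvalues M) `|z| <= (2 * \sum_i w (f i))%:R.
Proof.
(* One column per label: rows with equal labels coincide, rows with different labels have disjoint
   supports. *)
pose B : 'M[algC]_(n, #|T|) := \matrix_(i, c)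
  if f i == enum_val c then sqrtC (w (f i))%:R else 0.
pose C : 'M[algC]_n := \matrix_(i, j)
  if i == j then sqrtC (w (f i))%:R else 0.
have sqrt_conj k : (sqrtC k%:R : algC) * (sqrtC k%:R)^* = k%:R.
  by rewrite -normCK ger0_norm ?sqrtC_ge0 // sqrtCK.
have BE i j : (B *m B^t*) i j = if f i == f j then (w (f i))%:R else 0.
  rewrite mxE (bigD1 (enum_rank (f i))) //= big1 ?addr0 => [|c cN].
    rewrite !mxE enum_rankK eqxx [f j == _]eq_sym.
    by case: eqP => [<-|_]; rewrite ?sqrt_conj // rmorph0 mulr0.
  rewrite !mxE; case: eqP => [fi|_]; last by rewrite mul0r.
  by case/eqP: cN; rewrite fi enum_valK.
have CE i j : (C *m C^t*) i j = if i == j then (w (f i))%:R else 0.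
  rewrite mxE (bigD1 i) //= big1 ?addr0 => [|c cN].
    rewrite !mxE eqxx eq_sym.
    by case: eqP => [->|_]; rewrite ?sqrt_conj // rmorph0 mulr0.
  by rewrite !mxE eq_sym (negPf cN) mul0r.
have defM : M = B *m B^t* - C *m C^t*.
  apply/matrixP => i j; rewrite [RHS]mxE [X in _ + X]mxE BE CE mxE.
  by case: (eqVneq i j) => [->|_] /=; rewrite ?eqxx ?subrr ?subr0.
rewrite defM (le_trans (sum_norm_eigenvalues_subgram _ _)) //.
rewrite mul2n -addnn natrD natr_sum.
by apply: lerD; apply: ler_sum => i _; [rewrite BE eqxx | rewrite CE eqxx].
Qed.

End ClusterMatrix.

(** The remaining eigenvalues sum to -a, so by the triangle inequality their norms add up to at
    least |a|. *)
Lemma sum_norm_eigenvalues_ge n (A : 'M[algC]_n) a :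
  \tr A = 0 -> eigenvalue A a -> 2 * `|a| <= \sum_(z <- eigenvalues A) `|z|.
Proof.
move=> trA; rewrite -mem_eigenvalues => /perm_to_rem s_rem.
have := sum_eigenvalues A; rewrite trA !(perm_big _ s_rem) !big_cons /=.
move/eqP; rewrite addrC addr_eq0 => /eqP sumE.
by rewrite mulr2n mulrDl mul1r lerD2l -[`|a|]normrN -sumE ler_norm_sum.
Qed.

(** * Disjoint unions of cliques *)

Definition cluster_graph (G : simple_graph) : Prop :=
  forall u v w : G, adj u v -> adj v w -> u != w -> adj u w.

Section ClusterGraph.

Variable G : simple_graph.
Hypothesis clG : cluster_graph G.

Definition closed_neighbors (v : G) : {set G} := v |: neighbors v.

(* A clique with at most two vertices has no second neighbors. *)
Definition cluster_weight (A : {set G}) : nat :=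
  if (1 < #|A|.-1)%N then (#|A|.-1 ^ 2)%N else 0%N.

Lemma card_closed_neighbors v : #|closed_neighbors v| = (degree v).+1.
Proof. by rewrite cardsU1 inE adj_irrefl add1n. Qed.

(** The closed neighborhood of a vertex is its clique, so it can serve as the block label. *)
Lemma adj_closed_neighbors u v :
  adj u v = (u != v) && (closed_neighbors u == closed_neighbors v).
Proof.
have sub x y : adj x y -> closed_neighbors x \subset closed_neighbors y.
  move=> xy; apply/subsetP => z; rewrite !inE => /orP[/eqP->|xz].
    by rewrite adj_sym xy orbT.
  by case: eqVneq => //= zy; apply: clG xz _; rewrite 1?adj_sym // eq_sym.
apply/idP/andP => [uv|[uNv /eqP/setP/(_ v)]]; last first.
  by rewrite !inE eqxx /= eq_sym (negPf uNv).
split; first by apply: contraTneq uv => ->; rewrite adj_irrefl.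
by rewrite eqEsubset !sub // adj_sym.
Qed.

Lemma delta2_cluster v : delta2 v = cluster_weight (closed_neighbors v).
Proof.
rewrite /cluster_weight card_closed_neighbors /=.
have degE x : x \in neighbors v -> degree x = degree v.
  rewrite inE adj_closed_neighbors => /andP[_ /eqP eqN].
  by apply: succn_inj; rewrite -!card_closed_neighbors eqN.
have subN : second_neighbors v \subset neighbors v.
  apply/subsetP => x; rewrite !inE => /andP[xNv /bigcupP[u]].
  by rewrite !inE => vu ux; apply: clG ux _; rewrite // eq_sym.
rewrite /delta2; have -> : second_neighbors v = if (1 < degree v)%N then neighbors v else set0.
  case: ifP => [|dv].
    rewrite /degree => /card_gt1P[y [z [vy vz yNz]]].
    apply/eqP; rewrite eqEsubset subN; apply/subsetP => x vx.
    (* A path of length two from [v] to [x] needs a middle vertex other than [x]; one of [y], [z]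
       will do. *)
    have [u uv uNx] : exists2 u, u \in neighbors v & u != x.
      by case: (eqVneq y x) yNz => [<- | ?]; [exists z; rewrite // eq_sym | exists y].
    rewrite !inE in vx uv *; apply/andP; split.
      by apply: contraTneq vx => ->; rewrite adj_irrefl.
    apply/bigcupP; exists u; rewrite inE //.
    by apply: clG vx _; rewrite // adj_sym.
  apply/setP => x; rewrite [RHS]inE; apply/negP => x2.
  have vx := subsetP subN x x2.
  move: x2; rewrite !inE => /andP[_ /bigcupP[u]]; rewrite inE => vu.
  rewrite inE => ux; move/negP: dv; apply; apply/card_gt1P.
  exists u, x; rewrite inE; split=> //.
  by apply: contraTneq ux => ->; rewrite adj_irrefl.
case: ifP => _ /=; last by rewrite big_set0.
by rewrite (eq_bigr _ degE) sum_nat_const -/(degree v) mulnn.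
Qed.

Lemma snm_cluster :
  snm G = cluster_mx (fun i => closed_neighbors (enum_val i)) cluster_weight.
Proof.
apply/matrixP => i j; rewrite !mxE /= adj_closed_neighbors !delta2_cluster.
rewrite (inj_eq enum_val_inj) andbA andbb.
by case: ifP => // /andP[_ /eqP ->]; rewrite minnn.
Qed.

Lemma cluster_graph_msn_integral : msn_integral G.
Proof. by move=> a; rewrite snm_cluster; apply: eigenvalue_cluster_mx_int. Qed.

Lemma msn_energy_cluster_le : msn_energy G <= (2 * \sum_(v : G) delta2 v)%:R.
Proof.
rewrite /msn_energy snm_cluster (le_trans (sum_norm_eigenvalues_cluster_mx _ _)) //.
rewrite ler_nat leq_mul2l /= (eq_bigr _ (fun v _ => delta2_cluster v)).
by rewrite [leqRHS]big_enum_val.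
Qed.

End ClusterGraph.

(** * Comparison with the complete graph *)

Lemma complete_graph_cluster n : cluster_graph (complete_graph n).
Proof. by []. Qed.

Lemma degree_complete_graph n (v : complete_graph n) : degree v = n.-1.
Proof.
rewrite /degree; have -> : neighbors v = [set~ v].
  by apply/setP => u; rewrite !inE eq_sym.
by rewrite cardsC1 card_ord.
Qed.

(** For n = 2 the matrix vanishes and the bound fails. *)
Lemma msn_energy_complete_ge n : (2 < n)%N ->
  (2 * n.-1 ^ 3)%:R <= msn_energy (complete_graph n).
Proof.
move=> n_gt2; have clK := @complete_graph_cluster n.
have -> : (2 * n.-1 ^ 3)%:R = 2 * `|(n.-1 ^ 3)%:R : algC| by rewrite normr_nat -natrM.
apply: sum_norm_eigenvalues_ge; rewrite snm_cluster //.
  exact: mxtrace_cluster_mx.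
have n_gt0 : (0 < #|complete_graph n|)%N by rewrite card_ord; case: n n_gt2 {clK}.
(* The all-ones vector has eigenvalue (n - 1)^2 (n - 1). *)
apply/eigenvalueP; exists (const_mx 1); last first.
  by apply/rV0Pn; exists (Ordinal n_gt0); rewrite mxE oner_eq0.
apply/rowP => j; rewrite mulmx_cluster_mx.
(* There is a single block, since all closed neighborhoods are the full vertex set. *)
rewrite (eq_bigl xpredT) => [|i]; last first.
  apply/eqP/setP => u; rewrite !inE /= /complete_adj.
  by rewrite -!(eq_sym u) !orbN.
rewrite /cluster_weight card_closed_neighbors degree_complete_graph /=.
rewrite ltn_predRL n_gt2 (eq_bigr (fun=> 1)) => [|i _]; last by rewrite mxE.
rewrite sumr_const !mxE mulr1 !card_ord.
have -> : n%:R - 1 = n.-1%:R :> algC.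
  by rewrite -{1}(prednK (ltnW (ltnW n_gt2))) -natr1 addrK.
by rewrite -natrM -expnSr.
Qed.

Lemma cluster_graph_not_msn_hyperenergetic (G : simple_graph) :
  cluster_graph G -> (2 < #|G|)%N ->
  (forall u : G, exists2 v : G, u != v & ~~ adj u v) ->
  ~ msn_hyperenergetic G.
Proof.
move=> clG n_gt2 nadj; apply/negP; rewrite /msn_hyperenergetic -real_leNgt; last 2 first.
- by rewrite ger0_real // sumr_ge0.
- by rewrite ger0_real // sumr_ge0.
apply: le_trans (msn_energy_complete_ge n_gt2).
apply: le_trans (msn_energy_cluster_le clG) _.
rewrite ler_nat leq_mul2l /=; set n := #|G| in n_gt2 *.
have deg_le (v : G) : (degree v <= n.-2)%N.
  have [u vNu vu] := nadj v.
  have : neighbors v \subset ~: [set v; u].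
    apply/subsetP => x; rewrite !inE => vx; apply/norP.
    by split; [apply: contraTneq vx => -> | apply: contraTneq vx => ->];
      rewrite ?adj_irrefl.
  by move/subset_leq_card; rewrite [leqRHS]cardsCs setCK cards2 vNu subn2.
apply: leq_trans (_ : n * n.-2 ^ 2 <= _)%N.
  rewrite -sum_nat_const; apply: leq_sum => v _.
  rewrite delta2_cluster // /cluster_weight card_closed_neighbors /=.
  by case: ifP => // _; rewrite leq_sqr.
(* With n = k + 2 the claim reads (k + 2) k^2 <= (k + 1)^3. *)
clear -n_gt2; case: n n_gt2 => [|[|k]] //= _; rewrite !expnS !expn0; nia.
Qed.

(** * Commutants as additive subgroups *)

Section Centralizers.

Variable R : finNzRingType.

Definition commutant (A : {set R}) : {set R} :=
  [set x | [forall a in A, x * a == a * x]].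

Lemma commutantP (A : {set R}) x :
  reflect {in A, forall a, x * a = a * x} (x \in commutant A).
Proof. by rewrite inE; apply: (iffP forall_inP) => h a /h/eqP. Qed.

Lemma commutant_group_set A : group_set (commutant A).
Proof.
apply/group_setP; split=> [|x y /commutantP xA /commutantP yA].
  by apply/commutantP => a _; rewrite mul0r mulr0.
by apply/commutantP => a aA; rewrite FinRing.zmodMgE mulrDl mulrDr xA ?yA.
Qed.

Canonical commutant_group A := Group (commutant_group_set A).

Lemma commutantS (A B : {set R}) : A \subset B -> commutant B \subset commutant A.
Proof.
move=> /subsetP AB; apply/subsetP => x /commutantP xB.
by apply/commutantP => a /AB /xB.
Qed.

Lemma commutant_proper (A B : {set R}) x b :
  A \subset B -> x \in commutant A -> b \in B -> x * b != b * x ->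
  commutant B \proper commutant A.
Proof.
move=> AB xA bB xb; apply/properP; split; first exact: commutantS.
by exists x => //; apply: contraNN xb => /commutantP ->.
Qed.

Lemma ring_centerE : ring_center R = commutant setT.
Proof.
apply/setP => x; rewrite !inE.
by apply/forallP/forall_inP => h y; [rewrite h | rewrite h ?inE].
Qed.

Lemma notin_ring_center x :
  reflect (exists y, x * y != y * x) (x \notin ring_center R).
Proof. by rewrite inE negb_forall; apply: existsP. Qed.

(* Otherwise the commutants of [R], of the commutant of [y], of [{x, y}], of
   [y] and of the empty set form a strict chain of nonzero subgroups of [R]. *)
Lemma commute_trans_noncentral (p : nat) (x y z : R) :
  prime p -> #|R| = (p ^ 4)%N -> y \notin ring_center R ->
  x * y = y * x -> y * z = z * y -> x * z = z * x.
Proof.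
move=> p_pr cardR yNZ xy yz; apply/eqP/negPn/negP => xz.
have pG (A : {group R}) : (p.-group A)%g.
  by apply: pgroupS (subsetT A) _; rewrite /pgroup cardsT cardR pnatX pnat_id.
have [t yt] := notin_ring_center _ yNZ.
have inC a b : a * b = b * a -> a \in commutant [set b].
  by move=> ab; apply/commutantP => c /set1P ->.
have xC := inC _ _ xy; have zC : z \in commutant [set y] by exact: inC.
(* The group law is addition, so the trivial group is {0}; the unity of the ring is a nonzero
   central element. *)
have c0 : [1 R]%g \proper commutant setT.
  rewrite properE sub1G; apply/subsetPn; exists 1.
    by apply/commutantP => a _; rewrite mul1r mulr1.
  by rewrite inE oner_eq0.
have c1 : commutant setT \proper commutant (commutant [set y]).
  apply: (@commutant_proper _ _ y t); rewrite ?subsetT ?in_setT //.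
  by apply/commutantP => a /commutantP ->; rewrite ?inE.
(* Here [x] separates the two: it commutes with [x] and [y], but not with [z], which lies in the
   commutant of [y]. *)
have c2 : commutant (commutant [set y]) \proper commutant [set x; y].
  apply: (@commutant_proper _ _ x z) => //.
    by apply/subsetP => a /set2P[] -> //; apply: inC.
  by apply/commutantP => a /set2P[] ->.
have c3 : commutant [set x; y] \proper commutant [set y].
  apply: (@commutant_proper _ _ z x); rewrite ?in_set2 ?eqxx ?subsetUr // eq_sym //.
have c4 : commutant [set y] \proper commutant set0.
  apply: (@commutant_proper _ _ t y); rewrite ?sub0set ?in_set1 1?eq_sym //.
  by apply/commutantP => a; rewrite inE.
have lt (A B : {group R}) : A \proper B -> (logn p #|A| < logn p #|B|)%N.
  exact: properG_ltn_log.
have le4 : (logn p #|commutant set0| <= 4)%N.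
  rewrite -[leqRHS](pfactorK 4 p_pr) -cardR -cardsT.
  by rewrite dvdn_leq_log ?cardsT ?cardR ?expn_gt0 ?prime_gt0 // -cardR -cardsT
    (cardSg (subsetT (commutant_group set0))).
(* Each of the five strict inclusions raises the exponent of p in the order by at least one, which
   exceeds 4. *)
move: le4; rewrite leqNgt => /negP; apply.
apply: leq_ltn_trans (lt _ _ c4); apply: leq_ltn_trans (lt _ _ c3).
apply: leq_ltn_trans (lt _ _ c2); apply: leq_ltn_trans (lt _ _ c1).
exact: leq_ltn_trans (lt _ _ c0).
Qed.

End Centralizers.

(** * The commuting graph *)

(** An element that fails to commute with [u] is itself noncentral, hence a vertex. *)
Lemma commuting_graph_nonadj (R : finNzRingType) (u : commuting_graph R) :
  exists2 v : commuting_graph R, u != v & ~~ adj u v.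
Proof.
have /notin_ring_center[y uy] := valP u.
have yNZ : y \notin ring_center R by apply/notin_ring_center; exists (val u); rewrite eq_sym.
exists (Sub y yNZ); last by rewrite /= /commuting_adj negb_and SubK uy orbT.
by apply: contraNneq uy => ->; rewrite SubK.
Qed.

(** If x and y do not commute, then x, y and x + y are noncentral, and distinct because x and y are
    nonzero. *)
Lemma card_commuting_graph_gt2 (R : finNzRingType) :
  ~ commutative (fun x y : R => x * y) -> (2 < #|commuting_graph R|)%N.
Proof.
move=> ncR.
have /existsP[x /existsP[y xy]] : [exists x : R, [exists y : R, x * y != y * x]].
  apply: contra_notT ncR; rewrite negb_exists => /forallP nxy x y.
  by have := nxy x; rewrite negb_exists => /forallP/(_ y); rewrite negbK => /eqP.
have yx : y * x != x * y by rewrite eq_sym.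
have xNZ : x \notin ring_center R by apply/notin_ring_center; exists y.
have yNZ : y \notin ring_center R by apply/notin_ring_center; exists x.
have sNZ : x + y \notin ring_center R.
  by apply/notin_ring_center; exists y; rewrite mulrDl mulrDr (can_eq (addrK _)).
rewrite card_sub; apply: leq_trans (_ : 2 < #|[set x; y; (x + y)%R]|)%N _.
  rewrite -setUA !cardsU1 cards1 !inE.
  have -> : (x == y) = false by apply: contraNF xy => /eqP ->.
  have -> : (x == x + y) = false.
    by rewrite -{1}[x]addr0 (can_eq (addKr _)); apply: contraNF xy => /eqP <-;
      rewrite mulr0 mul0r.
  have -> : (y == x + y) = false => //.
  by rewrite -{1}[y]add0r (can_eq (addrK _)); apply: contraNF xy => /eqP <-;
    rewrite mulr0 mul0r.
by apply/subset_leq_card/subsetP => z /setUP[/set2P[]|/set1P] ->.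
Qed.

Theorem theorem3p2 (p : nat) (R : finNzRingType)
  (hp : prime p)
  (hR : ~ commutative (fun x y : R => x * y))
  (hcard : #|R| = (p ^ 4)%N) :
  msn_integral (commuting_graph R) /\ ~ msn_hyperenergetic (commuting_graph R).
Proof.
have clR : cluster_graph (commuting_graph R).
  move=> u v w /andP[_ /eqP uv] /andP[_ /eqP vw] uw.
  apply/andP; split=> //; apply/eqP.
  exact: commute_trans_noncentral hp hcard (valP v) uv vw.
split; first exact: cluster_graph_msn_integral.
apply: cluster_graph_not_msn_hyperenergetic => //.
  exact: card_commuting_graph_gt2.
exact: commuting_graph_nonadj.
Qed.
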